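(* Let $m\ge0$ be an integer and let $\alpha>m-1$ be real. Let $0<\tilde z_1<\tilde z_2<\tilde z_3<\cdots$ denote the positive zeros of the Bessel function of the first kind $J_\alpha$, and for $n>m$ let $0<z_{n,1}<z_{n,2}<\dots<z_{n,n-m}$ be the regular zeros (the zeros in $(0,\infty)$) of the type II exceptional Laguerre polynomial $L^{\mathrm{II}(\alpha)}_{m,n}$. Then for each fixed $i\ge1$, $$\lim_{n\to\infty} n\,z_{n,i}=\frac{\tilde z_i^{\,2}}{4}.$$
   Context: For real $\alpha$ and integer $n\ge 0$, $L^{(\alpha)}_n(z)=\sum_{k=0}^n \binom{n+\alpha}{n-k}\frac{(-z)^k}{k!}$ is the classical Laguerre polynomial (generalized binomial coefficients), and $L^{(\alpha)}_{-1}:=0$. Put $\eta_{\alpha,m}(z)=L^{(-\alpha)}_m(z)$ and $A^{\mathrm{II}}_{\alpha,m}[y]=z\,\eta_{\alpha,m}\,y'+(\alpha-m)\,\eta_{\alpha+1,m}\,y$. For $n\ge m\ge0$ and $j=n-m$, the degree $n$ type II exceptional Laguerre polynomial is $L^{\mathrm{II}(\alpha)}_{m,n}=-A^{\mathrm{II}}_{\alpha+1,m}\big[L^{(\alpha+1)}_{j}\big]$, i.e. $L^{\mathrm{II}(\alpha)}_{m,n}(z)=z\,L^{(-\alpha-1)}_m(z)L^{(\alpha+2)}_{j-1}(z)+(m-\alpha-1)L^{(-\alpha-2)}_m(z)L^{(\alpha+1)}_j(z)$. For $\alpha>m-1$ it has exactly $n-m$ zeros in $(0,\infty)$, all simple.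 *)

(* Defs.v *)
From HB Require Import structures.
From mathcomp Require Import all_boot all_order all_algebra.
From mathcomp Require Import all_classical all_reals all_analysis.
From mathcomp Require Import ring.
Set Implicit Arguments.
Unset Strict Implicit.
Unset Printing Implicit Defensive.
Import Order.TTheory GRing.Theory Num.Theory.
Import numFieldNormedType.Exports.
Local Open Scope classical_set_scope.
Local Open Scope ring_scope.

Definition gbinom (R : realType) (x : R) (k : nat) : R :=
  (\prod_(i < k) (x - i%:R)) / k`!%:R.

Definition laguerre (R : realType) (alpha : R) (n : nat) : {poly R} :=
  \poly_(k < n.+1) (gbinom (n%:R + alpha) (n - k) * (-1) ^+ k / k`!%:R).

Definition eta (R : realType) (alpha : R) (m : nat) : {poly R} :=
  laguerre (- alpha) m.

Definition opAII (R : realType) (alpha : R) (m : nat) (y : {poly R}) :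
    {poly R} :=
  'X * eta alpha m * y^`() + (alpha - m%:R) *: (eta (alpha + 1) m * y).

(* Only meaningful for m <= n, since n - m is truncated. *)
Definition laguerreII (R : realType) (alpha : R) (m n : nat) : {poly R} :=
  - opAII (alpha + 1) m (laguerre (alpha + 1) (n - m)).

(* Euler's integral, which is the Gamma function for x > 0 only. *)
Definition Gamma (R : realType) (x : R) : R :=
  \int[@lebesgue_measure R]_(t in `]0, +oo[) (t `^ (x - 1) * expR (- t)).

(* The Bessel function of the first kind at x > 0 and for order alpha > -1, so
   that all arguments of Gamma are positive. *)
Definition besselJ (R : realType) (alpha x : R) : R :=
  limn (series (fun k : nat =>
    (-1) ^+ k / (k`!%:R * Gamma (k%:R + alpha + 1))
      * (x / 2) `^ (2 * k%:R + alpha))).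

(* z, restricted to the index set I, lists in increasing order and without
   repetition all the zeros of f in ]0, +oo[. *)
Definition lists_pos_zeros (R : realType) (f : R -> R) (I : set nat)
    (z : nat -> R) : Prop :=
  (forall i j, I i -> I j -> (i < j)%N -> z i < z j) /\
  z @` I = [set x | 0 < x /\ f x = 0].

Lemma deriv_laguerreS (R : realType) (alpha : R) (n : nat) :
  (laguerre alpha n.+1)^`() = - laguerre (alpha + 1) n.
Proof.
apply/polyP => k; rewrite coef_deriv coefN !coef_poly ltnS.
case: ifP => _; last by rewrite mul0rn oppr0.
have -> : n.+1%:R + alpha = n%:R + (alpha + 1) by rewrite -natr1; ring.
rewrite subSS exprS factS natrM -mulr_natr invfM.
have k0 : k.+1%:R != 0 :> R by rewrite pnatr_eq0.
have f0 : k`!%:R != 0 :> R by rewrite pnatr_eq0 -lt0n fact_gt0.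
by field; rewrite f0 /= addrC natr1.
Qed.

Lemma laguerreIIE (R : realType) (alpha : R) (m n : nat) :
  laguerreII alpha m n =
    'X * laguerre (- alpha - 1) m
       * (if (n - m)%N is j.+1 then laguerre (alpha + 2) j else 0)
    + (m%:R - alpha - 1) *:
        (laguerre (- alpha - 2) m * laguerre (alpha + 1) (n - m)).
Proof.
rewrite /laguerreII /opAII /eta.
have -> : - (alpha + 1) = - alpha - 1 by ring.
have -> : - (alpha + 1 + 1) = - alpha - 2 by ring.
have -> : m%:R - alpha - 1 = - (alpha + 1 - m%:R) by ring.
rewrite opprD scaleNr; congr (_ + _).
case: (n - m)%N => [|j].
  have /size1_polyC -> : (size (laguerre (alpha + 1) 0) <= 1)%N.
    exact: size_poly.
  by rewrite derivC !mulr0 oppr0.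
by rewrite deriv_laguerreS mulrN opprK -addrA.
Qed.

(* Main.v *)
(* On ]0, +oo[, J_alpha(x) is a nonvanishing multiple of f(x^2/4) for the entire
   function f(t) = \sum_k (-1)^k t^k / (k! Gamma(k + alpha + 1)), so the numbers
   zt_i^2 / 4 are the positive zeros of f. They are simple, by an energy argument
   on the differential equation satisfied by f. The rescaled polynomials
   q_n(x) = c_n L^II_(m,n)(x / n) and their derivatives converge locally uniformly
   to f and f' up to a nonzero constant factor: the coefficients of the rescaled
   Laguerre polynomials converge and are dominated by 1 / k!, while the fixed
   polynomial factors, evaluated at x / n, tend to their value at 0. An elementary
   form of Hurwitz's theorem (a sign change at each zero of f gives a zero of q_n
   nearby, and q_n' <> 0 there makes it unique) then yields the convergence of the
   i-th zero by induction on i. *)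
Require Import Defs.
From HB Require Import structures.
From mathcomp Require Import all_boot all_order all_algebra.
From mathcomp Require Import all_classical all_reals all_analysis.
From mathcomp Require Import ring lra.
From mathcomp Require polyrcf.
Set Implicit Arguments.
Unset Strict Implicit.
Unset Printing Implicit Defensive.
Import Order.TTheory GRing.Theory Num.Theory.
Import numFieldNormedType.Exports.
Local Open Scope classical_set_scope.
Local Open Scope ring_scope.

(** * The Gamma function *)

Lemma Rintegral_FTC2 (R : realType) (f F : R -> R) (a b : R) : a < b ->
  {in `[a, b], forall x : R, is_derive x 1 F (f x)} ->
  {within `[a, b], continuous f} ->
  \int[@lebesgue_measure R]_(x in `[a, b]) f x = F b - F a.
Proof.
move=> ab dF cf; rewrite /Rintegral (@continuous_FTC2 _ f F) //.
  have cF x : x \in `[a, b] -> {for x, continuous F}.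
    move=> /dF dFx.
    exact/differentiable_continuous/derivable1_diffP/ex_derive.
  split=> [x xab||].
  - have xab' : x \in `[a, b] by apply: subset_itv_oo_cc.
    by have dFx := dF x xab'; exact: ex_derive.
  - by apply/cvg_at_right_filter/cF; rewrite in_itv/= lexx ltW.
  - by apply/cvg_at_left_filter/cF; rewrite in_itv/= lexx ltW.
move=> x xab; have xab' : x \in `[a, b] by apply: subset_itv_oo_cc.
by have dFx := dF x xab'; rewrite derive1E derive_val.
Qed.

Section gamma_function.
Context {R : realType}.
Implicit Types x t : R.
Local Notation mu := (@lebesgue_measure R).

Let g x t : R := t `^ (x - 1) * expR (- t).

(** The offset 2 gives [lo n < 1 < hi n] already for n = 0, so no interval is degenerate. *)
Let lo n : R := n.+2%:R^-1.
Let hi n : R := n.+2%:R.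
(* The integrand is singular at 0 when x < 1 and its domain is unbounded: both
   defects disappear on the compact sets K n, which exhaust ]0, +oo[. *)
Let K n := [set` `[lo n, hi n]].
Let GK n x := \int[mu]_(t in K n) g x t.

Let lo_gt0 n : 0 < lo n. Proof. by rewrite invr_gt0. Qed.

Let lo_lt_hi n : lo n < hi n.
Proof.
rewrite (@lt_trans _ _ 1) // ?invf_lt1 // /hi -[ltLHS]/(1%:R) ltr_nat//.
Qed.

Let itvK n t : t \in `[lo n, hi n] -> 0 < t.
Proof. by rewrite in_itv/= => /andP[/(lt_le_trans (lo_gt0 n))]. Qed.

Let is_derive_g x t : 0 < t ->
  is_derive t 1 (fun s => - (s `^ x * expR (- s))) (g (x + 1) t - x * g x t).
Proof.
move=> t0; have dpow := is_derive1_powR x t0.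
apply: is_derive_eq.
rewrite /g /GRing.scale/=.
have -> : x + 1 - 1 = x by ring.
by ring.
Qed.

Let continuous_g x t : 0 < t -> {for t, continuous (g x)}.
Proof.
move=> t0; have dpow := is_derive1_powR (x - 1) t0.
apply/differentiable_continuous/derivable1_diffP; apply: ex_derive.
Qed.

Let within_g x n : {within K n, continuous (g x)}.
Proof.
apply: continuous_in_subspaceT => t; rewrite inE => /itvK; exact: continuous_g.
Qed.

Let mK n : measurable (K n). Proof. exact: measurable_itv. Qed.

Let g_ge0 x t : 0 <= g x t.
Proof. by rewrite mulr_ge0 ?powR_ge0 ?expR_ge0. Qed.

Let integrable_g x n : mu.-integrable (K n) (EFin \o g x).
Proof. by apply: continuous_compact_integrable => //; exact: segment_compact. Qed.

(** Integration by parts on a compact interval: the functional equation of Gamma up to boundary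
    terms, which [bdry_cvg] sends to 0. *)
Let GK_rec x n :
  GK n (x + 1) = x * GK n x + (lo n `^ x * expR (- lo n) - hi n `^ x * expR (- hi n)).
Proof.
have := @Rintegral_FTC2 R (fun t => g (x + 1) t - x * g x t) _ _ _ (lo_lt_hi n)
  (fun t tK => is_derive_g x (itvK tK)).
have within_xg : {within K n, continuous (fun t => x * g x t)}.
  by move=> t; apply: cvgM; [exact: cvg_cst | exact: within_g].
have integrable_xg : mu.-integrable (K n) (EFin \o (fun t => x * g x t)).
  by apply: continuous_compact_integrable => //; exact: segment_compact.
rewrite RintegralB//; last exact: integrable_g.
rewrite RintegralZl//; last exact: integrable_g.
rewrite -/(K n) -/(GK n x) -/(GK n (x + 1)) => /(_ _)/wrap[|H].
  by move=> t; apply: cvgB; [exact: within_g | exact: within_xg].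
rewrite -[LHS](subrK (x * GK n x)) H; ring.
Qed.

(** One half of the exponential decay absorbs the power: t^x is at most 1 for t <= 1, and for t > 1
    it is at most t^(N+1), which the Taylor term of exp(t/2) of degree N+1 controls. The constant is
    the sum of the bounds for the two cases. *)
Let g_bound x : 0 < x ->
  exists2 C : R, 0 < C & forall t : R, 0 < t -> t `^ x * expR (- t) <= C * expR (- (t / 2)).
Proof.
move=> x0; have [N xN] : exists N, x <= N.+1%:R.
  exists (Num.bound x); apply/ltW/(lt_trans (archi_boundP (ltW x0))).
  by rewrite ltr_nat.
exists (1 + 2 ^+ N.+1 * N.+1`!%:R) => [|t t0].
  by rewrite addr_gt0// mulr_gt0 ?exprn_gt0// ltr0n fact_gt0.
have -> : expR (- t) = expR (- (t / 2)) * expR (- (t / 2)).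
  by rewrite -expRD; congr expR; field.
rewrite mulrA ler_pM2r ?expR_gt0// expRN ler_pdivrMr ?expR_gt0//.
have [t1|t1] := leP t 1.
  have h1 : t `^ x <= 1 by rewrite -(powRr0 t) ger_powR ?t0 ?t1 ?ltW.
  have h2 : 1 <= expR (t / 2) by rewrite -expR0 ler_expR divr_ge0// ltW.
  have h3 : 0 <= 2 ^+ N.+1 * N.+1`!%:R :> R by rewrite mulr_ge0.
  nra.
have h1 : t `^ x <= t ^+ N.+1 by rewrite -(powR_mulrn _ (ltW t0)) ler_powR// ltW.
have h2 := expR_ge1Dxn N (divr_ge0 (ltW t0) (ler0n R 2)).
have h3 : t ^+ N.+1 = (2 ^+ N.+1 * N.+1`!%:R) * ((t / 2) ^+ N.+1 / N.+1`!%:R).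
  rewrite expr_div_n; field.
  by rewrite -natrX !pnatr_eq0 -!lt0n fact_gt0 expn_gt0.
apply: (le_trans h1); rewrite h3.
have h4 : 0 <= 2 ^+ N.+1 * N.+1`!%:R :> R by rewrite mulr_ge0.
have h5 : (t / 2) ^+ N.+1 / N.+1`!%:R <= expR (t / 2) by apply: le_trans h2; lra.
have := expR_gt0 (t / 2).
nra.
Qed.

(** At argument x + 1 the integrand is t^x exp(-t) with x > 0, so there is no singularity at 0 and
    [g_bound] gives a majorant with an explicit antiderivative. *)
Let GKS_bounded x : 0 < x -> exists C : R, forall n, GK n (x + 1) <= C.
Proof.
move=> x0; have [C C0 gC] := g_bound x0.
exists (2 * C) => n.
pose h (t : R) : R := C * expR (- (t / 2)).
have dh (s : R) : is_derive s 1 (fun t => - (2 * C) * expR (- (t / 2))) (h s).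
  by apply: is_derive_eq; rewrite /h /GRing.scale/=; field.
have ch : continuous h.
  by move=> t; apply/differentiable_continuous/derivable1_diffP; apply: ex_derive.
have le1 : GK n (x + 1) <= \int[mu]_(t in K n) h t.
  apply: le_Rintegral; [exact: mK|exact: integrable_g| |].
    apply: continuous_compact_integrable => //; first exact: segment_compact.
    exact: continuous_subspaceT.
  by move=> t /itvK t0; rewrite /g addrK gC.
apply: (le_trans le1).
rewrite (Rintegral_FTC2 (lo_lt_hi n) (fun t _ => dh t)); last exact: continuous_subspaceT.
have := expR_gt0 (- (hi n / 2)).
have : expR (- (lo n / 2)) <= 1 by rewrite -expR0 ler_expR oppr_le0 divr_ge0// ltW.
nra.
Qed.

Let hi_cvg : hi @ \oo --> +oo%R.
Proof.
have := @cvgr_idn R; rewrite -(cvg_shiftn 2).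
by under [X in X @ _]eq_fun do rewrite addn2.
Qed.

Let lo_cvg : lo @ \oo --> (0 : R).
Proof. by have := @cvg_harmonic R; rewrite -cvg_shiftS. Qed.

Let bdry_cvg x : 0 < x ->
  (fun n => lo n `^ x * expR (- lo n) - hi n `^ x * expR (- hi n)) @ \oo --> (0 : R).
Proof.
move=> x0; rewrite -[0](subrr 0); apply: cvgB.
  apply: (@squeeze_cvgr _ _ _ _ (fun=> 0) (fun n => lo n `^ x)).
  - near=> n; rewrite mulr_ge0 ?powR_ge0 ?expR_ge0//=.
    by rewrite ler_piMr ?powR_ge0// -expR0 ler_expR oppr_le0 ltW//.
  - exact: cvg_cst.
  - have /cvg_at_rightP H := powR_cvg0 x0.
    exact: (H lo (conj lo_gt0 lo_cvg)).
have [C C0 gC] := g_bound x0.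
apply: (@squeeze_cvgr _ _ _ _ (fun=> 0) (fun n => C * expR (- (hi n / 2)))).
- near=> n; rewrite mulr_ge0 ?powR_ge0 ?expR_ge0//=.
  by apply: gC; rewrite ltr0n.
- exact: cvg_cst.
- rewrite -(mulr0 C); apply: cvgM; first exact: cvg_cst.
  have half_cvg : (fun r : R => r / 2) r @[r --> +oo] --> +oo%R.
    by apply: gt0_cvgMly => //; exact: cvg_id.
  exact: (cvg_comp _ _ (cvg_comp _ _ hi_cvg half_cvg) (@cvgr_expR R)).
Unshelve. all: by end_near. Qed.

Let cover_K : \bigcup_n K n = `]0, +oo[%classic.
Proof.
apply/seteqP; split=> t /=.
  by move=> [n _] /itvK t0; rewrite in_itv/= t0.
rewrite in_itv/= andbT => t0.
have [N tN] : exists N, t < N.+1%:R.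
  by exists (Num.bound t); rewrite (lt_trans (archi_boundP (ltW t0)))// ltr_nat.
have [M tM] : exists M, t^-1 < M.+1%:R.
  have tV0 : 0 <= t^-1 by rewrite invr_ge0 ltW.
  by exists (Num.bound t^-1); rewrite (lt_trans (archi_boundP tV0))// ltr_nat.
exists (N + M)%N => //; rewrite /K/= in_itv/=; apply/andP; split.
  rewrite /lo invf_ple ?posrE// (le_trans (ltW tM))// ler_nat.
  by rewrite -addSn -addnS leq_addl.
by rewrite (le_trans (ltW tN))// /hi ler_nat !ltnS -addnS leq_addr.
Qed.

Let nd_K : nondecreasing_seq K.
Proof.
move=> n p np; apply/subsetPset; apply: subset_itv; rewrite bnd_simp.
  by rewrite lef_pV2 ?posrE ?ltr0n// ler_nat.
by rewrite ler_nat.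
Qed.

(** The singular range 0 < x < 1 is reached from x + 1 by solving [GK_rec] for [GK n x]; the
    boundary terms are bounded because they converge. *)
Let GK_bounded x : 0 < x -> exists C : R, forall n, GK n x <= C.
Proof.
move=> x0; have [C GKC] := GKS_bounded x0.
have : bounded_fun (fun n => lo n `^ x * expR (- lo n) - hi n `^ x * expR (- hi n)).
  by apply: cvg_seq_bounded; apply/cvg_ex; exists 0; exact: bdry_cvg.
move=> [D [_ /(_ (D + 1))]]; rewrite ltrDl ltr01 => /(_ isT) HD.
exists ((C + (D + 1)) / x) => n.
rewrite ler_pdivlMr// mulrC.
have /= := HD n I; rewrite ler_norml => /andP[+ _].
have := GKC n; rewrite GK_rec.
lra.
Qed.

(** Monotone convergence takes place in the extended reals; the uniform bound shows that the limit
    is finite, without which [fine] would not carry the convergence over to R. *)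
Let GK_cvg x : 0 < x -> (GK ^~ x) @ \oo --> Gamma x.
Proof.
move=> x0; have [C GKC] := GK_bounded x0.
have GKE n : (\int[mu]_(t in K n) (g x t)%:E = (GK n x)%:E)%E.
  rewrite /GK /Rintegral fineK//.
  by apply: integrable_fin_num; [exact: mK | exact: integrable_g].
have GKoo : (\int[mu]_(t in K n) (g x t)%:E)%E @[n --> \oo] -->
    (\int[mu]_(t in `]0%R, +oo[) (g x t)%:E)%E.
  rewrite -cover_K; apply: ge0_nondecreasing_set_cvg_integral => //.
  - by move=> n; case/integrableP: (integrable_g x n).
  - by move=> n t _; rewrite lee_fin.
rewrite (_ : GK ^~ x = fine \o (fun n => \int[mu]_(t in K n) (g x t)%:E)%E)//.
apply: fine_cvg; rewrite fineK//.
rewrite ge0_fin_numE; last first.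
  by apply: integral_ge0 => t _; rewrite lee_fin; exact: g_ge0.
apply: (@le_lt_trans _ _ C%:E); last exact: ltry.
apply: cvge_le GKoo.
by near=> n; rewrite GKE lee_fin.
Unshelve. all: by end_near. Qed.

Lemma GammaS x : 0 < x -> Gamma (x + 1) = x * Gamma x.
Proof.
move=> x0; apply: (@cvg_unique _ _ (GK ^~ (x + 1) @ \oo)) => //.
  by apply: GK_cvg; rewrite addr_gt0.
rewrite (_ : GK ^~ (x + 1) = fun n => x * GK n x
   + (lo n `^ x * expR (- lo n) - hi n `^ x * expR (- hi n))); last first.
  by apply/funext => n; rewrite GK_rec.
rewrite -[x * _]addr0; apply: cvgD; last exact: bdry_cvg.
by apply: cvgM; [exact: cvg_cst | exact: GK_cvg].
Qed.

(** The truncated integrals increase to Gamma, and the first of them is positive because the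
    integrand has a positive minimum on [K 0]. *)
Lemma Gamma_gt0 x : 0 < x -> 0 < Gamma x.
Proof.
move=> x0; apply: (@lt_le_trans _ _ (GK 0 x)); last first.
  have ndGK : nondecreasing_seq (GK ^~ x).
    move=> n p np; rewrite fine_le//.
    - by apply: integrable_fin_num; [exact: mK | exact: integrable_g].
    - by apply: integrable_fin_num; [exact: mK | exact: integrable_g].
    apply: ge0_subset_integral; [exact: mK|exact: mK| | |].
    - by case/integrableP: (integrable_g x p).
    - by move=> t _; rewrite lee_fin; exact: g_ge0.
    - by rewrite -subsetEset; exact: nd_K.
  rewrite -(cvg_lim _ (GK_cvg x0))//; apply: nondecreasing_cvgn_le => //.
  by apply/cvg_ex; exists (Gamma x); exact: GK_cvg.
have [c cK gc] := EVT_min (ltW (lo_lt_hi 0)) (@within_g x 0).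
apply: (@lt_le_trans _ _ (\int[mu]_(t in K 0) g x c)).
  rewrite Rintegral_cst; last exact: mK.
  rewrite mulr_gt0//.
    by rewrite mulr_gt0 ?expR_gt0// powR_gt0// (itvK cK).
  rewrite /K/= lebesgue_measure_itv/= lte_fin lo_lt_hi/= subr_gt0.
  exact: lo_lt_hi.
apply: le_Rintegral; [exact: mK| |exact: integrable_g|].
  apply: continuous_compact_integrable; first exact: segment_compact.
  by move=> t; exact: cvg_cst.
by move=> t tK; exact: gc.
Qed.

End gamma_function.

(** * Convergence of the zeros *)

(* Equivalent to locally uniform convergence when the limit is continuous, but
   stable under sums and products by the usual limit lemmas. *)
Definition cvg_continuously (R : realType) (g : nat -> R -> R) (f : R -> R) : Prop :=
  forall x, g p.2 p.1 @[p --> (nbhs x, \oo)] --> f x.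

Section zeros_of_limits.
Context {R : realType}.
Implicit Types (f : R -> R) (q : nat -> {poly R}).

Lemma cvg_continuously_seq (g : nat -> R -> R) f (x : R) :
  cvg_continuously g f -> g n x @[n --> \oo] --> f x.
Proof.
move=> /(_ x); apply: (@cvg_comp _ _ _ (fun n => (x, n))).
by apply: cvg_pair; [exact: cvg_cst | exact: cvg_id].
Qed.

Lemma near_continuously_neq0 (g : nat -> R -> R) f (x : R) :
  cvg_continuously g f -> f x != 0 -> \forall t \near x & n \near \oo, g n t != 0.
Proof.
move=> /(_ x) gf fx0.
exact: (gf _ (open_nbhs_nbhs (conj (@open_neq R 0) fx0))).
Qed.

(** Multiplied by d, the difference quotients tend to d^2 > 0, so those at h and at -h have the same
    sign, which forces opposite signs of f on the two sides of w. *)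
Lemma simple_zero_sign_change f (w d e : R) : is_derive w 1 f d ->
  f w = 0 -> d != 0 -> 0 < e ->
  exists2 h, 0 < h < e & f (w - h) * f (w + h) < 0.
Proof.
move=> [df fd] fw0 d0 e0.
have : h^-1 *: (f (h + w) - f w) @[h --> 0^'] --> d.
  by rewrite -fd; move: df; rewrite /derivable /derive;
    under eq_fun do rewrite [_ *: 1]mulr1.
move=> quot.
have quotd : d * (h^-1 *: (f (h + w) - f w)) @[h --> 0^'] --> d * d.
  by apply: cvgM quot; exact: cvg_cst.
have dd0 : 0 < d * d by rewrite -expr2 exprn_even_gt0.
have [r /= r0 Hr] := cvgr_gt _ quotd _ dd0.
pose h := Num.min e r / 2.
have h0 : 0 < h by rewrite divr_gt0// lt_min e0.
have he : h < e by rewrite /h ltr_pdivrMr// gt_min; apply/orP; left; lra.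
have hr : h < r by rewrite /h ltr_pdivrMr// gt_min; apply/orP; right; lra.
exists h; first by rewrite h0.
have := Hr h; rewrite /ball_/= sub0r normrN gtr0_norm// => /(_ hr).
rewrite gt_eqF// fw0 subr0 => /(_ isT) /= H1.
have := Hr (- h); rewrite /ball_/= sub0r opprK gtr0_norm// => /(_ hr).
rewrite oppr_eq0 gt_eqF// fw0 subr0 => /(_ isT) /= H2.
have := mulr_gt0 H1 H2.
rewrite /GRing.scale/= invrN (addrC h) (addrC (- h)).
have -> : d * (h^-1 * f (w + h)) * (d * (- h^-1 * f (w - h))) =
  - ((d * d) * (h^-1 ^+ 2) * (f (w - h) * f (w + h))) by ring.
rewrite oppr_gt0 pmulr_rlt0// mulr_gt0// exprn_gt0// invr_gt0//.
Qed.

(** Since [y n] lists all positive roots of [q n] in order, locating [y n i] amounts to controlling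
    the indices of the roots found near or below [w i]. That [i <= N n] holds eventually belongs to
    the induction, as [y n i] need not be a root otherwise. *)
Lemma continuous_limit_zeros (q : nat -> {poly R}) f f' (N : nat -> nat)
    (w : nat -> R) (y : nat -> nat -> R) :
  (forall x : R, is_derive x 1 f (f' x)) ->
  cvg_continuously (fun n x => (q n).[x]) f ->
  cvg_continuously (fun n x => (q n)^`().[x]) f' ->
  f 0 != 0 ->
  (forall x, 0 < x -> f x = 0 -> f' x != 0) ->
  lists_pos_zeros f [set i | (1 <= i)%N] w ->
  (\forall n \near \oo,
    lists_pos_zeros (fun x => (q n).[x]) [set i | (1 <= i <= N n)%N] (y n)) ->
  forall i, (1 <= i)%N ->
    (\forall n \near \oo, (i <= N n)%N) /\ y n i @[n --> \oo] --> w i.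
Proof.
move=> df qf qf' f0 simple [w_incr w_zeros] y_lists.
have w_pos k : (1 <= k)%N -> 0 < w k /\ f (w k) = 0.
  move=> k1; have : (w @` [set i | (1 <= i)%N]) (w k) by exists k.
  by rewrite w_zeros.
elim/ltn_ind => i IH i1.
have [wi0 fwi] := w_pos i i1.
have pred1 : (1 < i)%N -> (1 <= i.-1)%N by case: (i) => [|[]].
(* The sign change of f across [w i] passes to [q n]. The resulting root has index at least i,
   because [y n i.-1] eventually lies below [w i - h]. *)
have upper e : 0 < e -> \forall n \near \oo, (i <= N n)%N /\ y n i <= w i + e.
  (* The gap to the previous zero, or to 0 when i = 1, keeps the new root positive and separated
     from [w i.-1]. *)
  move=> e0; pose e1 := Num.min e (w i - (if (1 < i)%N then w i.-1 else 0)).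
  have e10 : 0 < e1.
    rewrite lt_min e0/=; case: ifPn => i2; last by rewrite subr0.
    by rewrite subr_gt0 w_incr//= ?ltn_predL// pred1.
  have [h /andP[h0 he1] fneg] :=
    simple_zero_sign_change (df (w i)) fwi (simple _ wi0 fwi) e10.
  have [he hw] : h < e /\ (if (1 < i)%N then w i.-1 else 0) < w i - h.
    by move: he1; rewrite lt_min => /andP[-> ?]; split=> //; lra.
  have qneg : \forall n \near \oo, (q n).[w i - h] * (q n).[w i + h] < 0.
    have qcvg x : (q n).[x] @[n --> \oo] --> f x by exact: (@cvg_continuously_seq _ _ x qf).
    exact: (cvgr_lt _ (cvgM (qcvg (w i - h)) (qcvg (w i + h))) _ fneg).
  have ylow : \forall n \near \oo,
      (1 < i)%N -> (i.-1 <= N n)%N /\ y n i.-1 < w i - h.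
    move: hw; case: ifPn => i2 hw; last by near=> n.
    have [iN yc] := IH i.-1 (ltac:(by rewrite ltn_predL)) (pred1 i2).
    have {}yc : \forall n \near \oo, y n i.-1 < w i - h by exact: (cvgr_lt _ yc _ hw).
    by near=> n => _; split; near: n.
  near=> n.
  have [y_incr y_zeros] : lists_pos_zeros (fun x => (q n).[x])
    [set i | (1 <= i <= N n)%N] (y n) by near: n.
  have uv : w i - h <= w i + h by lra.
  have [|r rI rroot] := polyrcf.poly_ivt (p := q n) uv.
    by apply: ltW; near: n.
  have r0 : 0 < r.
    apply: lt_le_trans (_ : w i - h <= _); last by rewrite (itvP rI).
    by move: hw; case: ifPn => // i2; apply: lt_trans; exact: (w_pos _ (pred1 i2)).1.
  have : [set x | 0 < x /\ (q n).[x] = 0] r by split=> //; exact/eqP.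
  rewrite -y_zeros => -[k /= /andP[k1 kN] ykr].
  have ik : (i <= k)%N.
    rewrite leqNgt; apply/negP => ki.
    have i2 : (1 < i)%N by exact: leq_ltn_trans ki.
    have ki' : (k <= i.-1)%N by rewrite -ltnS prednK.
    have [iN ylt] : (i.-1 <= N n)%N /\ y n i.-1 < w i - h by move: i2; near: n.
    have : y n k <= y n i.-1.
      move: ki'; rewrite leq_eqVlt => /predU1P[->//|ki'].
      by apply/ltW/y_incr => //=; rewrite ?k1 ?pred1.
    rewrite ykr => /le_lt_trans /(_ ylt).
    by rewrite ltNge (itvP rI).
  split; first exact: leq_trans kN.
  apply: (@le_trans _ _ (y n k)); last first.
    by rewrite ykr (@le_trans _ _ (w i + h)) ?(itvP rI)// lerD2l ltW.
  move: ik; rewrite leq_eqVlt => /predU1P[->//|ik].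
  by apply/ltW/y_incr => //=; rewrite ?k1 ?i1//= (leq_trans (ltnW ik)).
split; first by apply: filterS (upper 1 ltr01) => n [].
apply/cvgrPdist_le => e e0.
(* Near a point of [0, w i - e] either f <> 0, or f' <> 0 and the only zero of
   q n is y n k with k < i; compactness makes this uniform. *)
have lower : \forall n \near \oo, `[0, w i - e]%classic `<=`
    (fun x => forall l, (1 <= l <= N n)%N -> x = y n l -> (l < i)%N).
  apply: (compact_near_coveringP `[0, w i - e]%classic).1.
    exact: segment_compact.
  move=> x /=; rewrite in_itv/= => /andP[x0 xw].
  have [fx0|fx0] := eqVneq (f x) 0; last first.
    have [[U V] /= [xU nV] UV] := near_continuously_neq0 qf fx0.
    exists (U, V `&` [set n | lists_pos_zeros (fun x => (q n).[x])
      [set i | (1 <= i <= N n)%N] (y n)]).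
      by split=> //=; exact: filterI.
    move=> [x' n] /= [Ux' [Vn [_ y_zeros]]] l lN x'y.
    have : (y n @` [set i | (1 <= i <= N n)%N]) (y n l) by exists l.
    rewrite y_zeros => -[_]; rewrite -x'y => /eqP.
    by have /negPf -> := UV (x', n) (conj Ux' Vn).
  have {}x0 : 0 < x by rewrite lt_def x0 andbT;
    apply: contraNneq f0 => xe; rewrite -[X in f X]xe fx0.
  have : [set x | 0 < x /\ f x = 0] x by [].
  rewrite -w_zeros => -[k /= k1 wkx].
  (* A zero of f at most [w i - e] precedes [w i], so the induction hypothesis applies to its
     index. *)
  have ki : (k < i)%N.
    rewrite ltnNge; apply/negP; rewrite leq_eqVlt => /predU1P[ik|ik].
      by move: xw; rewrite -wkx -ik; lra.
    by have := w_incr _ _ i1 k1 ik; rewrite wkx; lra.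
  have [kN yk] := IH k ki k1.
  have [[U V] /= [xU nV] UV] := near_continuously_neq0 qf' (simple x x0 fx0).
  move: xU => /nbhs_ballP[r /= r0 rU].
  have ykr : \forall n \near \oo, ball x r (y n k).
    by rewrite -wkx; apply: yk; exact: nbhsx_ballx.
  exists (ball x r, [set n | [/\ V n, ball x r (y n k), (k <= N n)%N &
     lists_pos_zeros (fun x => (q n).[x]) [set i | (1 <= i <= N n)%N] (y n)]]).
    split=> /=; first exact: nbhsx_ballx.
    by near=> n; split; near: n.
  move=> [x' n] /= [xx' [Vn xyk kNn [y_incr y_zeros]]] l lN x'y.
  suff -> : l = k by [].
  have y_root j : (1 <= j <= N n)%N -> (q n).[y n j] = 0.
    move=> jN; have : (y n @` [set i | (1 <= i <= N n)%N]) (y n j) by exists j.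
    by rewrite y_zeros => -[].
  (* By Rolle, two roots in the ball would enclose a zero of the derivative of [q n], which has none
     there. As [y n k] is in the ball, it is the only root. *)
  have no_two a b : ball x r a -> ball x r b -> (q n).[a] = 0 -> (q n).[b] = 0 ->
      a < b -> False.
    move=> xa xb qa qb ab.
    have [|c cab qc] := polyrcf.poly_rolle (p := q n) ab; first by rewrite qa qb.
    have /(UV (c, n))/= : U c /\ V n.
      split=> //; apply: rU; move: xa xb; rewrite /ball/= !ltr_norml => /andP[? ?] /andP[? ?].
      have ac : a < c by rewrite (itvP cab).
      have cb : c < b by rewrite (itvP cab).
      by apply/andP; split; lra.
    by rewrite qc eqxx.
  have kNn1 : (1 <= k <= N n)%N by rewrite k1.
  rewrite x'y in xx'.
  have [lk|kl|//] := ltngtP l k.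
    by case: (no_two _ _ xx' xyk (y_root _ lN) (y_root _ kNn1) (y_incr _ _ lN kNn1 lk)).
  by case: (no_two _ _ xyk xx' (y_root _ kNn1) (y_root _ lN) (y_incr _ _ kNn1 lN kl)).
near=> n.
have [iN yup] : (i <= N n)%N /\ y n i <= w i + e by near: n; exact: upper.
have iN1 : (1 <= i <= N n)%N by rewrite i1.
have ylow : w i - e <= y n i.
  rewrite leNgt; apply/negP => /ltW ylt.
  have [_ y_zeros] : lists_pos_zeros (fun x => (q n).[x])
    [set i | (1 <= i <= N n)%N] (y n) by near: n.
  have yni0 : 0 < y n i.
    have : (y n @` [set i | (1 <= i <= N n)%N]) (y n i) by exists i.
    by rewrite y_zeros => -[].
  have low : `[0, w i - e]%classic `<=`
    (fun x => forall l, (1 <= l <= N n)%N -> x = y n l -> (l < i)%N) by near: n.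
  have := low (y n i); rewrite /= in_itv/= ltW//= ylt => /(_ isT i iN1 erefl).
  by rewrite ltnn.
by rewrite ler_norml; apply/andP; split; lra.
Unshelve. all: by end_near. Qed.

End zeros_of_limits.

(** * Power series dominated by the exponential series *)

Definition psum (R : realType) (c : nat -> R) (x : R) : R := limn (pseries c x).

Section factorially_dominated_series.
Context {R : realType}.
Implicit Types (c : nat -> R) (x y r : R) (n k : nat).

(** This bound is stable under termwise differentiation, so it serves a series and all its
    derivatives at once. *)
Definition fact_dominated c := forall k, `|c k| <= (k`!%:R)^-1.

Lemma is_cvg_pseries_fact_dominated c x : fact_dominated c -> cvgn (pseries c x).
Proof.
move=> cdom; apply: normed_cvg; apply: (series_le_cvg (v_ := exp_coeff `|x|)).
- by move=> n; exact: normr_ge0.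
- by move=> n; exact: exp_coeff_ge0.
- move=> n /=; rewrite normrM normrX /exp_coeff /= mulrC.
  by rewrite ler_wpM2l ?exprn_ge0.
- exact: is_cvg_series_exp_coeff.
Qed.

(** The bound depends neither on c nor on x in the disc: this is the source of uniformity in the
    index of a sequence of polynomials. *)
Lemma psum_tail c x r n : fact_dominated c -> `|x| <= r ->
  `|psum c x - \sum_(0 <= k < n) c k * x ^+ k| <= expR r - series (exp_coeff r) n.
Proof.
move=> cdom xr; have r0 : 0 <= r := le_trans (normr_ge0 x) xr.
have cc : pseries c x @ \oo --> psum c x by exact: is_cvg_pseries_fact_dominated.
have nd : {homo series (exp_coeff r) : N M / (N <= M)%N >-> N <= M}.
  by apply: nondecreasing_series => k _ _; exact: exp_coeff_ge0.
have lhs : `|pseries c x N - pseries c x n| @[N --> \oo] --> `|psum c x - pseries c x n|.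
  by apply: cvg_norm; apply: cvgB => //; exact: cvg_cst.
apply: (cvgr_to_le lhs); near=> N.
have nN : (n <= N)%N by near: N; exists n.
apply: (@le_trans _ _ (series (exp_coeff r) N - series (exp_coeff r) n)); last first.
  by rewrite lerD2r; apply: nondecreasing_cvgn_le => //; exact: is_cvg_series_exp_coeff.
rewrite /pseries !sub_series_geq//.
apply: (le_trans (ler_norm_sum _ _ _)); apply: ler_sum => k _.
rewrite normrM normrX /exp_coeff/= mulrC; apply: ler_pM => //.
by apply: lerXn2r; rewrite ?nnegrE.
Unshelve. all: by end_near. Qed.

Lemma psum_poly (p : {poly R}) x : psum (fun k => p`_k) x = p.[x].
Proof.
apply: norm_lim_near_cst; near=> n.
rewrite /pseries/series/= big_mkord -horner_coef_wide//.
by near: n; exists (size p).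
Unshelve. all: by end_near. Qed.

Lemma fact_dominated_lim (u : nat -> nat -> R) c :
  (forall n, fact_dominated (u n)) -> (forall k, u n k @[n --> \oo] --> c k) ->
  fact_dominated c.
Proof.
move=> udom uc k; apply: (cvgr_to_le (cvg_norm (uc k))).
by near=> n; exact: udom.
Unshelve. all: by end_near. Qed.

Lemma poly_cvg_psum (p : nat -> {poly R}) c :
  (forall n, fact_dominated (fun k => (p n)`_k)) ->
  (forall k, (p n)`_k @[n --> \oo] --> c k) ->
  cvg_continuously (fun n x => (p n).[x]) (psum c).
Proof.
move=> pdom pc x; have cdom := fact_dominated_lim pdom pc.
apply/cvgrPdist_le => e e0.
(* The margin 1 leaves room for the evaluation point to move near x; the error is then split into
   two tails and one finite sum, each at most e / 3. *)
pose r := `|x| + 1.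
have [K tailK] : exists K, expR r - series (exp_coeff r) K <= e / 3.
  have /cvgrPdist_le/(_ (e / 3)) := @is_cvg_series_exp_coeff R r.
  rewrite divr_gt0// => /(_ isT) [K _ /(_ K (leqnn K))] /= H.
  by exists K; exact: le_trans (ler_norm _) H.
have partial : \sum_(0 <= k < K) (p q.2)`_k * q.1 ^+ k @[q --> (nbhs x, \oo)] -->
    \sum_(0 <= k < K) c k * x ^+ k.
  clear tailK; elim: K => [|K IH].
    by under eq_fun do rewrite big_geq//; rewrite big_geq//; exact: cvg_cst.
  under eq_fun do rewrite big_nat_recr//=.
  rewrite big_nat_recr//=; apply: cvgD => //; apply: cvgM.
    exact: (cvg_comp _ _ cvg_snd (pc K)).
  have powc : t ^+ K @[t --> (x : R)] --> (x : R) ^+ K by exact: exprn_continuous.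
  exact: (cvg_comp _ _ cvg_fst powc).
move/cvgrPdist_le : partial => /(_ (e / 3)); rewrite divr_gt0// => /(_ isT) partial.
have xball : \forall q \near (nbhs x, \oo), `|q.1 : R| <= r.
  have : \forall t \near x, `|t| <= r.
    near=> t.
    have : `|x - t| <= 1 by near: t; apply: cvgr_dist_le.
    move=> xt; rewrite -[t](subKr x) (le_trans (ler_normB _ _))//.
    by rewrite lerD2l.
  by move=> xr; apply: cvg_fst xr.
near=> q.
have q1 : `|q.1| <= r by near: q.
have q2 : `|\sum_(0 <= k < K) c k * x ^+ k - \sum_(0 <= k < K) (p q.2)`_k * q.1 ^+ k|
  <= e / 3 by near: q.
have t1 := psum_tail K (pdom q.2) q1; rewrite psum_poly in t1.
have t2 : `|x| <= r by rewrite /r lerDl.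
have {}t2 := psum_tail K cdom t2.
move: t1 t2 q2; rewrite !ler_norml => /andP[? ?] /andP[? ?] /andP[? ?].
by apply/andP; split; lra.
Unshelve. all: by end_near. Qed.

Lemma is_derive_psum c x : fact_dominated c -> fact_dominated (pseries_diffs c) ->
  fact_dominated (pseries_diffs (pseries_diffs c)) ->
  is_derive x 1 (psum c) (psum (pseries_diffs c) x).
Proof.
move=> c0 c1 c2; apply: (@pseries_snd_diffs _ _ (`|x| + 1));
  try exact: is_cvg_pseries_fact_dominated.
by rewrite [ltRHS]ger0_norm ?addr_ge0// ltrDl.
Qed.

Lemma psum0 c : psum c 0 = c 0%N.
Proof.
apply: norm_lim_near_cst; near=> n.
rewrite /pseries/series/= -(@prednK n); last by near: n; exists 1%N.
rewrite big_nat_recl//= expr0 mulr1 big1 ?addr0// => k _.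
by rewrite exprS mul0r mulr0.
Unshelve. all: by end_near. Qed.

(** Writes multiplication by x as a shift of coefficients, so that identities between series can be
    checked degree by degree. *)
Lemma pseries_shift_cvg c x : fact_dominated c ->
  pseries (fun k => if k is k'.+1 then c k' else 0) x @ \oo --> x * psum c x.
Proof.
move=> cdom; rewrite -cvg_shiftS.
rewrite (_ : (fun _ => _) = fun n => x * pseries c x n).
  apply: cvgM; first exact: cvg_cst.
  exact: is_cvg_pseries_fact_dominated.
apply/funext => n; rewrite /pseries/series/= big_nat_recl//= mul0r add0r mulr_sumr.
by apply: eq_bigr => k _; rewrite exprS; ring.
Qed.

End factorially_dominated_series.

(** * The Bessel function *)

Definition rising (R : realType) (x : R) (k : nat) : R := \prod_(i < k) (x + i%:R).

Lemma risingS (R : realType) (x : R) k : rising x k.+1 = rising x k * (x + k%:R).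
Proof. by rewrite /rising big_ord_recr. Qed.

Lemma rising_ge1 (R : realType) (x : R) k : 1 <= x -> 1 <= rising x k.
Proof.
move=> x1; elim: k => [|k IH]; first by rewrite /rising big_ord0.
rewrite risingS; have : 0 <= k%:R :> R by [].
nra.
Qed.

(** Coefficients of Gamma(alpha + 2) t^(-(alpha+1)/2) J_(alpha+1)(2 sqrt t). With the order alpha +
    1 the rising factorials start above 1, hence the domination by 1/k!; starting from alpha + 1,
    which may be below 1, this could fail. *)
Definition bessel_coef (R : realType) (alpha : R) (k : nat) : R :=
  (-1) ^+ k / (k`!%:R * rising (alpha + 2) k).

Lemma fact_dominated_diffs (R : realType) (c : nat -> R) :
  fact_dominated c -> fact_dominated (pseries_diffs c).
Proof.
move=> cdom k; rewrite /pseries_diffs normrM normr_nat.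
apply: (le_trans (ler_wpM2l (ler0n _ _) (cdom k.+1))).
by rewrite factS natrM invfM mulVKf.
Qed.

Section bessel.
Context {R : realType} (alpha : R).
Hypothesis alpha_gtN1 : -1 < alpha.

Local Notation a := (bessel_coef alpha).
Local Notation F0 := (psum a).
Local Notation F1 := (psum (pseries_diffs a)).
Local Notation F2 := (psum (pseries_diffs (pseries_diffs a))).

Let rising_gt0 k : 0 < rising (alpha + 2) k.
Proof. by apply: (lt_le_trans ltr01); apply: rising_ge1; have := alpha_gtN1; lra. Qed.

Lemma fact_dominated_bessel_coef : fact_dominated a.
Proof.
move=> k; rewrite normf_div normrX normrN1 expr1n div1r normrM invfM.
rewrite normr_nat gtr0_norm//.
by rewrite ler_piMr ?invr_ge0// invf_le1// rising_ge1//; have := alpha_gtN1; lra.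
Qed.

Let a_dom := fact_dominated_bessel_coef.
Let d1 := fact_dominated_diffs a_dom.
Let d2 := fact_dominated_diffs d1.
Let d3 := fact_dominated_diffs d2.

Let coef_rec k : (k%:R + alpha + 2) * pseries_diffs a k = - a k.
Proof.
rewrite /pseries_diffs /bessel_coef risingS factS natrM exprS.
have r0 := rising_gt0 k; have k0 : 0 < (k`!%:R : R) by rewrite ltr0n fact_gt0.
have k1 : 0 < (k.+1%:R : R) by [].
have ka : 0 < alpha + 2 + k%:R by have := alpha_gtN1; have : 0 <= k%:R :> R by []; lra.
field; rewrite !gt_eqF//=; lra.
Qed.

Lemma bessel_ode x : x * F2 x + (alpha + 2) * F1 x + F0 x = 0.
Proof.
have c2 := pseries_shift_cvg (x:=x) d2.
have c1 : pseries (pseries_diffs a) x @ \oo --> F1 x.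
  exact: is_cvg_pseries_fact_dominated.
have c0 : pseries a x @ \oo --> F0 x by exact: is_cvg_pseries_fact_dominated.
have := cvgD (cvgD c2 (cvgM (cvg_cst (alpha + 2)) c1)) c0.
rewrite (_ : _ + _ = cst 0); last first.
  apply/funext => n /=; rewrite /pseries/series/=.
  rewrite !fctE /= mulr_sumr -!big_split/= big1// => k _.
  (* The three terms of degree k cancel by [coef_rec], so every partial sum is already 0. *)
  transitivity (((k%:R + alpha + 2) * pseries_diffs a k + a k) * x ^+ k).
    by case: k => [|k]; rewrite /pseries_diffs; ring.
  by rewrite coef_rec addNr mul0r.
by move=> /(_ _ _ _ _) H; rewrite (cvg_unique _ H (cvg_cst 0)).
Qed.

(* The entire function Gamma (alpha + 2) * \sum_k (-1)^k x^k / (k! Gamma (k + alpha + 1)),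
   whose coefficients are (k + alpha + 1) * a k. *)
Definition bessel_fun x := x * F1 x + (alpha + 1) * F0 x.

Let is_derive_F0 (x : R) : is_derive x 1 F0 (F1 x).
Proof. exact: is_derive_psum. Qed.

Let is_derive_F1 (x : R) : is_derive x 1 F1 (F2 x).
Proof. exact: is_derive_psum. Qed.

(** The product rule gives x F2 + (alpha + 2) F1, which the differential equation collapses to
    -F0. *)
Lemma is_derive_bessel_fun (x : R) : is_derive x 1 bessel_fun (- F0 x).
Proof.
have ? := is_derive_F0 x; have ? := is_derive_F1 x.
apply: is_derive_eq; rewrite /GRing.scale/= -[in RHS](subr0 (F0 x)) -(bessel_ode x); ring.
Qed.

(** At a double zero x > 0 both F0 and F1 would vanish, that is, a solution of a second-order linear
    equation would have zero Cauchy data. *)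
Lemma bessel_fun_simple x : 0 < x -> bessel_fun x = 0 -> - F0 x != 0.
Proof.
move=> x0; rewrite /bessel_fun oppr_eq0 => fx; apply/negP => /eqP F0x.
have {fx} F1x : F1 x = 0.
  by move: fx; rewrite F0x mulr0 addr0 => /eqP; rewrite mulf_eq0 gt_eqF//= => /eqP.
have [N N1 Na] : exists2 N, 1 <= N.+1%:R :> R & 2 * alpha + 3 <= N.+1%:R :> R.
  exists (Num.bound (2 * alpha + 3)); first by rewrite ler1n.
  have b : 0 <= 2 * alpha + 3 by have := alpha_gtN1; lra.
  by apply/ltW/(lt_trans (archi_boundP b)); rewrite ltr_nat.
(* The ODE gives (F0^2 + t F1^2)' = - (2 alpha + 3) F1^2, so that the factor
   t^(N+1) makes G nondecreasing as soon as 2 alpha + 3 <= N + 1; as G x = 0, F0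
   vanishes on ]0, x], contradicting F0 0 = 1. *)
pose G (t : R) := t ^+ N.+1 * (F0 t * F0 t + t * (F1 t * F1 t)).
have dG (t : R) : is_derive t 1 G
    (t ^+ N * (N.+1%:R * F0 t ^+ 2 + (N.+1%:R - (2 * alpha + 3)) * (t * F1 t ^+ 2))).
  have ? := is_derive_F0 t; have ? := is_derive_F1 t.
  have ? : is_derive t 1 (fun s : R => s ^+ N.+1) (N.+1%:R * t ^+ N).
    by apply: DeriveDef; [exact: exprn_derivable | rewrite exp_derive/= [LHS]mulr1].
  rewrite /G; apply: is_derive_eq; rewrite /GRing.scale/=.
  have -> : F0 t = - (t * F2 t + (alpha + 2) * F1 t).
    by rewrite -[LHS]subr0 -(bessel_ode t); ring.
  by rewrite exprS -natr1; ring.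
have G_ge0 t : 0 <= t -> 0 <= G t.
  move=> t0; rewrite /G -!expr2 mulr_ge0 ?exprn_ge0//; apply: addr_ge0.
    exact: sqr_ge0.
  by rewrite mulr_ge0// sqr_ge0.
have Gle t : 0 <= t <= x -> G t <= G x.
  move=> /andP[t0 tx].
  apply: (@ger0_derive1_ndecr _ G 0 x) => // [s|].
  - rewrite in_itv/= => /andP[s0 sx]; rewrite derive1E derive_val.
    apply: mulr_ge0; first by rewrite exprn_ge0// ltW.
    apply: addr_ge0; first by rewrite mulr_ge0// sqr_ge0.
    by rewrite mulr_ge0 ?subr_ge0// mulr_ge0 ?sqr_ge0// ltW.
  - by apply: derivable_within_continuous => s _; exact: ex_derive.
have Gx : G x = 0 by rewrite /G F0x F1x !mulr0 addr0 mulr0.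
have F0t t : 0 < t <= x -> F0 t = 0.
  move=> /andP[t0 tx]; have := Gle t; rewrite ltW// tx Gx => /(_ isT) Gt.
  have : G t = 0 by apply/eqP; rewrite eq_le Gt G_ge0// ltW.
  move/eqP; rewrite /G -!expr2 mulf_eq0 expf_eq0/= (gt_eqF t0)/=.
  rewrite paddr_eq0; [|exact: sqr_ge0|by rewrite mulr_ge0 ?sqr_ge0 ?ltW].
  by rewrite sqrf_eq0 => /andP[/eqP].
have F00 : F0 0 = 1.
  by rewrite psum0 /bessel_coef /rising big_ord0 expr0 fact0 mulr1 divr1.
have : F0 t @[t --> 0^'+] --> (F0 0 : R).
  have ? := is_derive_F0 0.
  exact/cvg_at_right_filter/differentiable_continuous/derivable1_diffP/ex_derive.
have : F0 t @[t --> 0^'+] --> (0 : R).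
  apply: cvg_near_cst; near=> t; apply: F0t; apply/andP; split=> //.
  by near: t; exact: nbhs_right_le.
move=> H0 H1; have : (0 : R) = F0 0 by exact: (cvg_unique _ H0 H1).
by rewrite F00 => /eqP; rewrite eq_sym oner_eq0.
Unshelve. all: by end_near. Qed.

End bessel.

(** * Passage from the zeros of [besselJ] to those of [bessel_fun] *)

Lemma Gamma_rising (R : realType) (x : R) k : 0 < x ->
  Gamma (x + k%:R) = rising x k * Gamma x.
Proof.
move=> x0; elim: k => [|k IH]; first by rewrite addr0 /rising big_ord0 mul1r.
rewrite -natr1 addrA GammaS ?ltr_wpDr// IH risingS; ring.
Qed.

Lemma besselJE (R : realType) (alpha x : R) : -1 < alpha -> 0 < x ->
  besselJ alpha x =
    (x / 2) `^ alpha / Gamma (alpha + 2) * bessel_fun alpha (x ^+ 2 / 4).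
Proof.
move=> alpha_gtN1 x0; set t := x ^+ 2 / 4; set C := (x / 2) `^ alpha / _.
have a_dom := fact_dominated_bessel_coef alpha_gtN1.
have c1 := pseries_shift_cvg (x := t) (fact_dominated_diffs a_dom).
have c0 : pseries (bessel_coef alpha) t @ \oo --> psum (bessel_coef alpha) t.
  exact: is_cvg_pseries_fact_dominated.
pose S n := C * (pseries (fun k => if k is k'.+1
  then pseries_diffs (bessel_coef alpha) k' else 0) t n
  + (alpha + 1) * pseries (bessel_coef alpha) t n).
have S_cvg : S n @[n --> \oo] --> C * bessel_fun alpha t.
  apply: cvgM; first exact: cvg_cst.
  by apply: cvgD => //; apply: cvgM => //; exact: cvg_cst.
apply: (@cvg_lim R^o); first exact: Rhausdorff.
rewrite [X in X @ _ --> _](_ : _ = S)//; apply/funext => n.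
rewrite /S /pseries/series/= mulr_sumr -big_split/= mulr_sumr.
apply: eq_bigr => k _.
transitivity (C * ((k%:R + alpha + 1) * bessel_coef alpha k * t ^+ k)); last first.
  by case: k => [|k]; rewrite /pseries_diffs; ring.
have x2 : 0 < x / 2 by rewrite divr_gt0.
have k0 : 0 <= k%:R :> R by [].
have ka : 0 < k%:R + alpha + 1 by lra.
have a2 : 0 < alpha + 2 by lra.
(* Both sides equal Gamma(k + alpha + 2); this turns the Gamma factors of the Bessel series into
   [bessel_coef]. *)
have GE : (k%:R + alpha + 1) * Gamma (k%:R + alpha + 1) =
    rising (alpha + 2) k * Gamma (alpha + 2).
  rewrite -GammaS// -Gamma_rising//; congr Gamma; ring.
have G0 := Gamma_gt0 ka; have G20 := Gamma_gt0 a2.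
have r0 : 0 < rising (alpha + 2) k.
  by apply: (lt_le_trans ltr01); apply: rising_ge1; lra.
have f0 : 0 < (k`!%:R : R) by rewrite ltr0n fact_gt0.
have -> : (x / 2) `^ (2 * k%:R + alpha) = t ^+ k * (x / 2) `^ alpha.
  rewrite powRD; last by rewrite (gt_eqF x2) implybT.
  rewrite -natrM powR_mulrn ?ltW// exprM /t; congr (_ ^+ _ * _); by field.
rewrite /C /bessel_coef.
have -> : rising (alpha + 2) k =
   (k%:R + alpha + 1) * Gamma (k%:R + alpha + 1) / Gamma (alpha + 2).
  by rewrite GE mulfK// gt_eqF.
by field; rewrite !gt_eqF.
Qed.

Lemma lists_pos_zeros_bessel_fun (R : realType) (alpha : R) (I : set nat)
    (zt : nat -> R) : -1 < alpha -> lists_pos_zeros (besselJ alpha) I zt ->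
  lists_pos_zeros (bessel_fun alpha) I (fun i => zt i ^+ 2 / 4).
Proof.
move=> alpha_gtN1 [zt_incr zt_zeros].
have JE x : 0 < x -> (besselJ alpha x = 0) <-> (bessel_fun alpha (x ^+ 2 / 4) = 0).
  move=> x0; rewrite besselJE//; split=> [/eqP|->]; last by rewrite mulr0.
  have a2 : 0 < alpha + 2 by lra.
  rewrite mulf_eq0 gt_eqF/=; first by move/eqP.
  apply: divr_gt0; last exact: Gamma_gt0.
  by apply: powR_gt0; rewrite divr_gt0.
have zt_pos i : I i -> 0 < zt i /\ besselJ alpha (zt i) = 0.
  move=> Ii; have : (zt @` I) (zt i) by exists i.
  by rewrite zt_zeros.
split=> [i j Ii Ij ij|].
  rewrite ltr_pM2r ?invr_gt0// ltrXn2r//.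
  - by rewrite ltW//; have [] := zt_pos i Ii.
  - exact: zt_incr.
apply/seteqP; split=> [_ [i Ii <-]|t [t0 ft]] /=.
  have [zi0 /JE fz] := zt_pos i Ii.
  by split; [rewrite divr_gt0// exprn_gt0 | exact: fz].
have tE : (2 * Num.sqrt t) ^+ 2 / 4 = t by rewrite exprMn sqr_sqrtr ?ltW//; field.
have : [set x | 0 < x /\ besselJ alpha x = 0] (2 * Num.sqrt t).
  have s0 : 0 < 2 * Num.sqrt t by rewrite mulr_gt0// sqrtr_gt0.
  by split=> //; apply/JE; rewrite ?tE.
rewrite -zt_zeros => -[i Ii zi]; exists i => //.
by rewrite zi.
Qed.

(** * Laguerre polynomials *)

Lemma coef_comp_scaleX (R : comNzRingType) (p : {poly R}) (c : R) k :
  (p \Po (c *: 'X))`_k = p`_k * c ^+ k.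
Proof.
rewrite comp_polyE coef_sum.
under eq_bigr do rewrite exprZn coefZ coefZ coefXn mulrA.
have [kp|pk] := ltnP k (size p).
  rewrite (bigD1 (Ordinal kp))//= eqxx mulr1 big1 ?addr0// => i ik.
  suff /negPf -> : k != i by rewrite mulr0.
  by apply: contraNneq ik => ki; apply/eqP/val_inj.
rewrite nth_default// mul0r big1// => i _.
by rewrite gtn_eqF ?mulr0// (leq_trans (ltn_ord i)).
Qed.

Lemma horner_comp_scaleX (R : comNzRingType) (p : {poly R}) (c x : R) :
  (p \Po (c *: 'X)).[x] = p.[c * x].
Proof. by rewrite horner_comp hornerZ hornerX. Qed.

Lemma deriv_comp_scaleX (R : comNzRingType) (p : {poly R}) (c : R) :
  (p \Po (c *: 'X))^`() = c *: (p^`() \Po (c *: 'X)).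
Proof. by rewrite deriv_comp derivZ derivX alg_polyC mulrC mul_polyC. Qed.

Section generalized_binomials.
Context {R : realType}.
Implicit Types (x beta : R) (j k m : nat).

Lemma laguerre_at0 beta j : (laguerre beta j).[0] = gbinom (j%:R + beta) j.
Proof.
by rewrite horner_coef0 coef_poly/= subn0 expr0 fact0 mulr1 divr1.
Qed.

(** The last k factors of the falling product (j + beta)...(1 + beta), read backwards, form the
    rising factorial of beta + 1. *)
Lemma gbinom_falling_rising beta j k : (k <= j)%N ->
  gbinom (j%:R + beta) (j - k) * rising (beta + 1) k =
  gbinom (j%:R + beta) j * (j ^_ k)%:R.
Proof.
move=> kj; rewrite /gbinom.
have f0 i : i`!%:R != 0 :> R by rewrite pnatr_eq0 -lt0n fact_gt0.
have jf : j`!%:R = (j ^_ k)%:R * (j - k)`!%:R :> R by rewrite -natrM ffact_fact.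
have jk0 : (j ^_ k)%:R != 0 :> R by rewrite pnatr_eq0 -lt0n ffact_gt0.
suff -> : \prod_(i < j) (j%:R + beta - i%:R) =
    \prod_(i < j - k) (j%:R + beta - i%:R) * rising (beta + 1) k.
  by rewrite jf; field; rewrite f0 jk0.
rewrite /rising -(big_mkord xpredT (fun i => j%:R + beta - i%:R)).
rewrite (@big_cat_nat _ _ _ (j - k))//= ?leq_subr// big_mkord; congr (_ * _).
rewrite -{1}[(j - k)%N]add0n big_addn subKn// big_mkord.
rewrite (reindex_inj rev_ord_inj); apply: eq_bigr => i _ /=.
have ik := ltn_ord i.
have -> : ((k - i.+1) + (j - k) = j - i.+1)%N by rewrite addnC addnBA// subnK.
rewrite natrB ?(leq_trans ik)// -natr1; ring.
Qed.

(** Both sides are x (x - 1)...(x - m) / m!. *)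
Lemma gbinom_pred x m : x * gbinom (x - 1) m = (x - m%:R) * gbinom x m.
Proof.
rewrite /gbinom !mulrA; congr (_ / _).
have -> : \prod_(i < m) (x - 1 - i%:R) = \prod_(i < m) (x - i.+1%:R).
  by apply: eq_bigr => i _; rewrite -natr1; ring.
transitivity (\prod_(i < m.+1) (x - i%:R)); first by rewrite big_ord_recl/= subr0.
by rewrite big_ord_recr/= mulrC.
Qed.

Lemma gbinom_gt0 beta j : -1 < beta -> 0 < gbinom (j%:R + beta) j.
Proof.
move=> b1; rewrite divr_gt0 ?ltr0n ?fact_gt0//; apply: prodr_gt0 => i _.
have : i.+1%:R <= j%:R :> R by rewrite ler_nat.
rewrite -natr1; lra.
Qed.

Lemma gbinom_neg_neq0 x m : x < 0 -> gbinom x m != 0.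
Proof.
move=> x0; rewrite mulf_neq0 ?invr_neq0 ?pnatr_eq0 -?lt0n ?fact_gt0//.
apply/prodf_neq0 => i _; rewrite lt_eqF//.
have : 0 <= i%:R :> R by [].
lra.
Qed.

(** The falling factorial vanishes beyond the degree, so one formula covers every k. *)
Lemma laguerre_coef (alpha : R) j k :
  (laguerre (alpha + 1) j)`_k * rising (alpha + 2) k =
  gbinom (j%:R + (alpha + 1)) j * (j ^_ k)%:R * ((-1) ^+ k / k`!%:R).
Proof.
rewrite coef_poly ltnS; case: leqP => [kj|jk]; last first.
  by rewrite ffact_small// mulr0 !mul0r.
have -> : alpha + 2 = (alpha + 1) + 1 by ring.
rewrite -gbinom_falling_rising//; ring.
Qed.

Lemma ffact_ratio_le1 j n k : (j <= n)%N -> (j ^_ k)%:R / n%:R ^+ k <= 1 :> R.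
Proof.
move=> jn; elim: k => [|k IH]; first by rewrite ffactn0 expr0 divr1.
(* For n = 0 the quotient is 0, the inverse of 0 being 0 by convention. *)
have [->|n0] := posnP n; first by rewrite expr0n/= invr0 mulr0.
rewrite ffactnSr natrM exprSr -mulf_div mulr_ile1//.
rewrite ler_pdivrMr ?ltr0n// mul1r ler_nat.
exact: leq_trans (leq_subr _ _) jn.
Qed.

Lemma ffact_ratio_cvg m k :
  ((n - m) ^_ k)%:R / n%:R ^+ k @[n --> \oo] --> (1 : R).
Proof.
elim: k => [|k IH].
  under eq_fun do rewrite ffactn0 expr0 divr1.
  exact: cvg_cst.
under eq_fun do rewrite ffactnSr natrM exprSr -mulf_div.
have step : (n - m - k)%:R / n%:R @[n --> \oo] --> (1 : R).
  have : (1 - (m + k)%:R * n%:R^-1) @[n --> \oo] --> (1 - (m + k)%:R * 0 : R).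
    apply: cvgB; first exact: cvg_cst.
    apply: cvgM; first exact: cvg_cst.
    by apply/gtr0_cvgV0; [near=> n; rewrite ltr0n; near: n; exists 1%N | exact: cvgr_idn].
  rewrite mulr0 subr0; apply: cvg_trans; apply: near_eq_cvg; near=> n.
  have mkn : (m + k <= n)%N by near: n; exists (m + k)%N.
  have n0 : n%:R != 0 :> R by rewrite pnatr_eq0 -lt0n; near: n; exists 1%N.
  by rewrite -subnDA natrB// mulrBl divff.
have /(_ _ _) := cvgM IH step; rewrite mulr1; exact.
Unshelve. all: by end_near. Qed.

End generalized_binomials.

Lemma fact_dominated_deriv (R : realType) (p : {poly R}) :
  fact_dominated (fun k => p`_k) -> fact_dominated (fun k => p^`()`_k).
Proof.
move=> /fact_dominated_diffs pdom k.
by rewrite coef_deriv -[_ *+ k.+1]mulr_natl; exact: pdom.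
Qed.

Lemma coef_deriv_cvg (R : realType) (p : nat -> {poly R}) (c : nat -> R) :
  (forall k, (p n)`_k @[n --> \oo] --> c k) ->
  forall k, (p n)^`()`_k @[n --> \oo] --> pseries_diffs c k.
Proof.
move=> pc k; under eq_fun do rewrite coef_deriv -[_ *+ k.+1]mulr_natl.
by apply: cvgM; [exact: cvg_cst | exact: pc].
Qed.

Lemma cvgn_natV (R : realType) : (n%:R : R)^-1 @[n --> \oo] --> (0 : R).
Proof.
apply/gtr0_cvgV0; last exact: cvgr_idn.
by near=> n; rewrite ltr0n; near: n; exists 1%N.
Unshelve. all: by end_near. Qed.

Lemma horner_shrink_cvg (R : realType) (p : {poly R}) :
  cvg_continuously (fun n x => p.[n%:R^-1 * x]) (fun=> p.[0]).
Proof.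
move=> x.
have : q.2%:R^-1 * q.1 @[q --> (nbhs x, \oo)] --> (0 * x : R).
  apply: cvgM; last exact: cvg_fst.
  exact: (cvg_comp _ _ cvg_snd (@cvgn_natV R)).
rewrite mul0r => H.
have pc : p.[t] @[t --> (0 : R)] --> p.[0] by exact: continuous_horner.
exact: (cvg_comp _ _ H pc).
Qed.

Lemma eq_cvg_continuously (R : realType) (g h : nat -> R -> R) (f f' : R -> R) :
  (forall n x, g n x = h n x) -> f =1 f' ->
  cvg_continuously g f -> cvg_continuously h f'.
Proof.
move=> gh ff' gf x; rewrite -ff'.
by under eq_fun do rewrite -gh; exact: gf.
Qed.

(** * Exceptional Laguerre polynomials rescaled by 1/n *)

Section scaled_exceptional_laguerre.
Context {R : realType} (m : nat) (alpha : R).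
Hypothesis alpha_gt : m%:R - 1 < alpha.

Lemma laguerreII_order_gtN1 : -1 < alpha.
Proof. by have := alpha_gt; have : 0 <= m%:R :> R by []; lra. Qed.

Let alpha_gtN1 := laguerreII_order_gtN1.

(* The value at 0 of laguerre (alpha + 1) (n - m). *)
Definition laguerreII_scale n : R := gbinom ((n - m)%:R + (alpha + 1)) (n - m).
Local Notation N0 := laguerreII_scale.

Let p n := (N0 n)^-1 *: (laguerre (alpha + 1) (n - m) \Po (n%:R^-1 *: 'X)).

Definition scaled_laguerreII n : {poly R} :=
  (N0 n)^-1 *: (laguerreII alpha m n \Po (n%:R^-1 *: 'X)).

Local Notation q := scaled_laguerreII.
Local Notation A := (Defs.eta (alpha + 1) m).
Local Notation B := (Defs.eta (alpha + 1 + 1) m).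
Local Notation a := (bessel_coef alpha).

Let N0_gt0 n : 0 < N0 n.
Proof. by apply: gbinom_gt0; have := alpha_gtN1; lra. Qed.

Let rising_gt0 k : 0 < rising (alpha + 2) k.
Proof. by apply: (lt_le_trans ltr01); apply: rising_ge1; have := alpha_gtN1; lra. Qed.

(** All dependence on n sits in a ratio that is at most 1 and tends to 1, which yields both
    domination and convergence of the coefficients. *)
Let coef_p n k : (p n)`_k = a k * (((n - m) ^_ k)%:R / n%:R ^+ k).
Proof.
rewrite coefZ coef_comp_scaleX exprVn /bessel_coef.
have r0 := rising_gt0 k; have n0 := N0_gt0 n.
have f0 : 0 < (k`!%:R : R) by rewrite ltr0n fact_gt0.
have -> : (laguerre (alpha + 1) (n - m))`_k =
    N0 n * ((n - m) ^_ k)%:R * ((-1) ^+ k / k`!%:R) / rising (alpha + 2) k.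
  by rewrite -laguerre_coef mulfK// gt_eqF.
move: (_ ^+ k)^-1 => nVk; field.
by rewrite !gt_eqF.
Qed.

Let p_dom n : fact_dominated (fun k => (p n)`_k).
Proof.
move=> k; rewrite coef_p normrM.
apply: le_trans (fact_dominated_bessel_coef alpha_gtN1 k).
by rewrite ler_piMr// ger0_norm ?ffact_ratio_le1 ?leq_subr.
Qed.

Let p_coef_cvg k : (p n)`_k @[n --> \oo] --> a k.
Proof.
under eq_fun do rewrite coef_p.
have /(_ _ _ _) := cvgM (cvg_cst (a k)) (ffact_ratio_cvg m k); rewrite mulr1; exact.
Qed.

Let p0_cvg := poly_cvg_psum p_dom p_coef_cvg.

Let p1_cvg : cvg_continuously (fun n x => (p n)^`().[x]) (psum (pseries_diffs a)).
Proof.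
apply: poly_cvg_psum; first by move=> n; exact: fact_dominated_deriv.
exact: coef_deriv_cvg.
Qed.

Let p2_cvg : cvg_continuously (fun n x => (p n)^`()^`().[x])
  (psum (pseries_diffs (pseries_diffs a))).
Proof.
apply: poly_cvg_psum; first by move=> n; do 2!apply: fact_dominated_deriv.
by do 2!apply: coef_deriv_cvg.
Qed.

(** The value is a generalized binomial with upper entry m - alpha - 1, negative exactly because
    alpha > m - 1. It keeps the limit function from being identically zero. *)
Lemma eta_at0_neq0 : A.[0] != 0.
Proof.
rewrite /Defs.eta laguerre_at0; apply: gbinom_neg_neq0.
by have := alpha_gt; lra.
Qed.

(** This relation lets A(0) be factored out of the limit, leaving x F1 + (alpha + 1) F0, that is,
    [bessel_fun]. *)
Let AB0 : (alpha + 1 - m%:R) * B.[0] = (alpha + 1) * A.[0].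
Proof.
rewrite /Defs.eta !laguerre_at0.
have -> : m%:R + - (alpha + 1 + 1) = (m%:R + - (alpha + 1)) - 1 by ring.
have := gbinom_pred (m%:R + - (alpha + 1)) m.
set b := gbinom (_ - 1) m; set b' := gbinom _ m => H.
transitivity (- ((m%:R - (alpha + 1)) * b)); first by ring.
by rewrite H; ring.
Qed.

(** No stray power of n appears because the operator X d/dX is invariant under rescaling. *)
Let qE n : q n = - ('X * (A \Po (n%:R^-1 *: 'X)) * (p n)^`()
  + (alpha + 1 - m%:R) *: ((B \Po (n%:R^-1 *: 'X)) * p n)).
Proof.
rewrite /scaled_laguerreII /laguerreII /opAII /p derivZ deriv_comp_scaleX.
rewrite raddfN/= comp_polyD comp_polyZ !comp_polyM comp_polyX.
by rewrite -!mul_polyC; ring.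
Qed.

Lemma scaled_laguerreII_cvg :
  cvg_continuously (fun n x => (q n).[x]) (fun x => - A.[0] * bessel_fun alpha x).
Proof.
apply: (@eq_cvg_continuously _ (fun n x =>
  - (x * A.[n%:R^-1 * x] * (p n)^`().[x]
     + (alpha + 1 - m%:R) * (B.[n%:R^-1 * x] * (p n).[x])))
  _ (fun x => - (x * A.[0] * psum (pseries_diffs a) x
     + (alpha + 1 - m%:R) * (B.[0] * psum a x)))).
- by move=> n x; rewrite qE !hornerE !horner_comp_scaleX.
- move=> x; rewrite mulrA AB0 /bessel_fun; ring.
move=> x; apply: cvgN; apply: cvgD.
  apply: cvgM; last exact: p1_cvg.
  by apply: cvgM; [exact: cvg_fst | exact: horner_shrink_cvg].
apply: cvgM; first exact: cvg_cst.
by apply: cvgM; [exact: horner_shrink_cvg | exact: p0_cvg].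
Qed.

(** Terms that differentiate A or B carry a factor 1/n and disappear in the limit; the rest
    simplifies by [bessel_ode]. *)
Lemma deriv_scaled_laguerreII_cvg :
  cvg_continuously (fun n x => (q n)^`().[x]) (fun x => A.[0] * psum a x).
Proof.
apply: (@eq_cvg_continuously _ (fun n x =>
  - ((A.[n%:R^-1 * x] + x * (n%:R^-1 * A^`().[n%:R^-1 * x])) * (p n)^`().[x]
     + x * A.[n%:R^-1 * x] * (p n)^`()^`().[x]
     + (alpha + 1 - m%:R) * (n%:R^-1 * B^`().[n%:R^-1 * x] * (p n).[x]
       + B.[n%:R^-1 * x] * (p n)^`().[x])))
  _ (fun x => - ((A.[0] + x * (0 * A^`().[0])) * psum (pseries_diffs a) x
     + x * A.[0] * psum (pseries_diffs (pseries_diffs a)) x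
     + (alpha + 1 - m%:R) * (0 * B^`().[0] * psum a x
       + B.[0] * psum (pseries_diffs a) x)))).
- move=> n x; rewrite qE; move: (p n) => pn.
  rewrite derivN derivD derivZ !derivM derivX !deriv_comp_scaleX.
  by rewrite !hornerE !horner_comp_scaleX; ring.
- move=> x; rewrite mulrDr [X in _ + (_ + X)]mulrA AB0.
  have := bessel_ode alpha_gtN1 x.
  set F0 := psum a x; set F1 := psum (pseries_diffs a) x; set F2 := psum (pseries_diffs _) x => ode.
  have -> : F0 = - (x * F2 + (alpha + 2) * F1) by rewrite -[LHS]subr0 -ode; ring.
  ring.
have nV x : q.2%:R^-1 @[q --> (nbhs (x : R), \oo)] --> (0 : R).
  exact: (cvg_comp _ _ cvg_snd (@cvgn_natV R)).
move=> x; apply: cvgN; apply: cvgD; first apply: cvgD.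
- apply: cvgM; last exact: p1_cvg.
  apply: cvgD; first exact: horner_shrink_cvg.
  by apply: cvgM; [exact: cvg_fst | apply: cvgM; [exact: nV | exact: horner_shrink_cvg]].
- apply: cvgM; last exact: p2_cvg.
  by apply: cvgM; [exact: cvg_fst | exact: horner_shrink_cvg].
- apply: cvgM; first exact: cvg_cst.
  apply: cvgD.
    by apply: cvgM; [apply: cvgM; [exact: nV | exact: horner_shrink_cvg] | exact: p0_cvg].
  by apply: cvgM; [exact: horner_shrink_cvg | exact: p1_cvg].
Qed.

Lemma lists_pos_zeros_scaled n (I : set nat) (z : nat -> R) : (0 < n)%N ->
  lists_pos_zeros (fun x => (laguerreII alpha m n).[x]) I z ->
  lists_pos_zeros (fun x => (q n).[x]) I (fun i => n%:R * z i).
Proof.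
move=> n0 [z_incr z_zeros].
have n0R : 0 < n%:R :> R by rewrite ltr0n.
have q0 x : ((q n).[n%:R * x] = 0) <-> ((laguerreII alpha m n).[x] = 0).
  rewrite /scaled_laguerreII hornerZ horner_comp_scaleX mulrA mulVf ?gt_eqF// mul1r.
  split=> [/eqP|->]; last by rewrite mulr0.
  by rewrite mulf_eq0 invr_eq0 gt_eqF//= => /eqP.
split=> [i j Ii Ij ij|]; first by rewrite ltr_pM2l// z_incr.
apply/seteqP; split=> [_ [i Ii <-]|x [x0 qx]] /=.
  have : (z @` I) (z i) by exists i.
  by rewrite z_zeros => -[zi0 /q0]; rewrite mulr_gt0.
have xE : n%:R * (x / n%:R) = x by rewrite mulrC divfK// gt_eqF.
have : [set x | 0 < x /\ (laguerreII alpha m n).[x] = 0] (x / n%:R).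
  by split; [rewrite divr_gt0 | apply/q0; rewrite xE].
by rewrite -z_zeros => -[i Ii zi]; exists i => //; rewrite zi.
Qed.

End scaled_exceptional_laguerre.

Theorem corollary4p1 (R : realType) (m : nat) (alpha : R)
    (zt : nat -> R) (z : nat -> nat -> R) :
  m%:R - 1 < alpha ->
  lists_pos_zeros (besselJ alpha) [set i | (1 <= i)%N] zt ->
  (forall n : nat, (m < n)%N ->
    lists_pos_zeros (fun x => (laguerreII alpha m n).[x])
      [set i | (1 <= i <= n - m)%N] (z n)) ->
  forall i : nat, (1 <= i)%N ->
    (fun n : nat => n%:R * z n i) @ \oo --> zt i ^+ 2 / 4.
Proof.
move=> alpha_gt zt_lists z_lists i i1.
have alpha_gtN1 := laguerreII_order_gtN1 alpha_gt.
have eta_neq0 := eta_at0_neq0 alpha_gt.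
pose f x := - (Defs.eta (alpha + 1) m).[0] * bessel_fun alpha x.
have f_zero x : (f x = 0) <-> (bessel_fun alpha x = 0).
  split=> [/eqP|]; last by rewrite /f => ->; rewrite mulr0.
  by rewrite mulf_eq0 oppr_eq0 (negPf eta_neq0) => /eqP.
have df (x : R) : is_derive x 1 f ((Defs.eta (alpha + 1) m).[0] * psum (bessel_coef alpha) x).
  have ? := is_derive_bessel_fun alpha_gtN1 x.
  by apply: is_derive_eq; rewrite /GRing.scale/=; ring.
apply: (@continuous_limit_zeros R (scaled_laguerreII m alpha) f
  (fun x => (Defs.eta (alpha + 1) m).[0] * psum (bessel_coef alpha) x)
  (fun n => (n - m)%N) (fun i => zt i ^+ 2 / 4) (fun n i => n%:R * z n i)
  df (scaled_laguerreII_cvg alpha_gt) (deriv_scaled_laguerreII_cvg alpha_gt) _ _ _ _ i i1).2.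
(* At 0, [bessel_fun] takes the value alpha + 1 > 0. *)
- apply/eqP => /f_zero.
  rewrite /bessel_fun mul0r add0r psum0 /bessel_coef /rising big_ord0 expr0 fact0.
  by have := alpha_gtN1; lra.
- move=> x x0 /f_zero /(bessel_fun_simple alpha_gtN1 x0).
  by rewrite oppr_eq0 mulf_eq0 negb_or eta_neq0.
- have [w_incr w_zeros] := lists_pos_zeros_bessel_fun alpha_gtN1 zt_lists.
  split=> //; rewrite w_zeros; apply/seteqP; split=> x /= [x0 fx]; split=> //;
  exact/f_zero.
- near=> n; apply: (lists_pos_zeros_scaled alpha_gt); first by near: n; exists 1%N.
  by apply: z_lists; near: n; exists m.+1.
Unshelve. all: by end_near. Qed.
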